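(* Let $(G,X^* )$ be a contracting self-similar action with nucleus $\mathcal{N}$, limit $G$-space $\mathcal{X}_G$, quotient map $\pi:X^{-\omega}\times G\to\mathcal{X}_G$, and tile $\mathcal{T}\subset\mathcal{X}_G$. Then for all $g_1,g_2\in G$ $$\pi^{-1}\big((\mathcal{T}\cdot g_1)\cap(\mathcal{T}\cdot g_2)\big)=\bigcup_{\substack{h_1,h_2\in\mathcal{N}\\ g_1g_2^{-1}=h_1h_2^{-1}}}(F_{h_1}\cap F_{h_2})\cdot h_1^{-1}g_1,$$ where $F\cdot g$ denotes $F\times\{g\}\subset X^{-\omega}\times G$.
   Context: Let $X$ be a finite nonempty set, $X^*$ the set of finite words over $X$, and $X^{-\omega}$ the space of left-infinite sequences $\ldots x_2x_1$, $x_i\in X$, with the product topology. A faithful (left) action of a group $G$ on $X^*$ is self-similar if for every $g\in G$, $x\in X$ there exist $h\in G$, $y\in X$ such that $g(xw)=y\,h(w)$ for all $w\in X^*$; then $h$ is denoted $g|_x$, and $g|_{x_1\ldots x_n}=g|_{x_1}|_{x_2}\cdots|_{x_n}$. The action is contracting if there is a finite set $\mathcal{N}\subset G$ such that for every $g\in G$ there is $k$ with $g|_v\in\mathcal{N}$ for all words $v$ of length $\ge k$; the smallest such set $\mathcal{N}$ is the nucleus, regarded as a directed graph with vertex set $\mathcal{N}$ and an edge from $g$ to $g|_x$ labeled $(x,g(x))$ for all $g\in\mathcal{N}$, $x\in X$. For $h\in\mathcal{N}$, $F_h\subseteq X^{-\omega}$ is the set of sequences $\ldots x_2x_1$ for which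 there is a left-infinite path $\ldots e_2e_1$ in the nucleus ending in $h$ such that the first coordinate of the label of $e_i$ is $x_i$ for all $i$. Two elements $\ldots x_2x_1\cdot g$ and $\ldots y_2y_1\cdot h$ of $X^{-\omega}\times G$ ($G$ discrete) are asymptotically equivalent if there are a finite set $K\subset G$ and $g_n\in K$, $n\ge1$, with $g_n(x_n\ldots x_1)=y_n\ldots y_1$ and $g_n|_{x_n\ldots x_1}\cdot g=h$ for all $n\ge 1$. The limit $G$-space $\mathcal{X}_G$ is the quotient of $X^{-\omega}\times G$ by this relation, with $G$ acting from the right by multiplication on the $G$-coordinate. The tile $\mathcal{T}$ is $\pi(X^{-\omega}\times\{1\})$. *)

(* Defs.v *)
From HB Require Import structures.
From mathcomp Require Import all_boot.
From mathcomp Require Import all_classical topology.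
Set Implicit Arguments.
Unset Strict Implicit.
Unset Printing Implicit Defensive.

Local Open Scope classical_set_scope.
Local Open Scope quotient_scope.
Local Open Scope group_scope.

(* A word x_1 x_2 ... x_n is the sequence [:: x_1; x_2; ...; x_n]. *)
Record selfsim_action (G : groupType) (X : finType) := SelfSimAction {
  act :> G -> seq X -> seq X;
  act1 : forall w, act 1 w = w;
  actM : forall g h w, act (g * h) w = act g (act h w);
  act_faithful : forall g, (forall w, act g w = w) -> g = 1;
  act_selfsim : forall (g : G) (x : X),
    exists (h : G) (y : X), forall w, act g (x :: w) = y :: act h w
}.

Section SelfSimilar.
Variables (G : groupType) (X : finType) (A : selfsim_action G X).
Implicit Types (g h : G) (x y : X) (v w : seq X).

(* g|_x, well defined by self-similarity and faithfulness, see [restr1E] *)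
Definition restr1 g x : G :=
  xget 1 [set h | exists y, forall w, A g (x :: w) = y :: A h w].

(* g|_v for a word v *)
Definition restr g v : G := foldl restr1 g v.

(* g(x) for a letter x; the default value of [head] is never used since the
   word A g [:: x] has length 1, see [restr1E] *)
Definition letter_act g x : X := head x (A g [:: x]).

Definition absorbing (N : set G) : Prop :=
  finite_set N /\
  forall g, exists k : nat, forall v, (k <= size v)%N -> N (restr g v).

Definition contracting : Prop := exists N, absorbing N.

(* the smallest absorbing set of a contracting action, see [nucleusP] *)
Definition nucleus : set G := \bigcap_(N in absorbing) N.

(* The edge with source g and label (x, g(x)) is encoded by the pair (g, x). *)
Definition edge_source (e : G * X) : G := e.1.
Definition edge_target (e : G * X) : G := restr1 e.1 e.2.
Definition edge_label (e : G * X) : X * X := (e.2, letter_act e.1 e.2).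

(* Left-infinite sequences are indexed from the right: the left-infinite path
   ... e_2 e_1 is the function n |-> e_(n+1), and likewise for ... x_2 x_1. *)
Definition left_infinite_path (e : nat -> G * X) : Prop :=
  (forall n, nucleus (edge_source (e n))) /\
  (forall n, nucleus (edge_target (e n))) /\
  (forall n, edge_target (e n.+1) = edge_source (e n)).

Definition left_seq : topologicalType :=
  {ptws nat -> discrete_topology X}.

Definition nucleusF (h : G) : set left_seq :=
  [set xi | exists e, left_infinite_path e /\ edge_target (e 0%N) = h /\
                      forall n, (edge_label (e n)).1 = xi n].

(* the word x_n ... x_1 *)
Definition suffix_word (xi : left_seq) (n : nat) : seq X := rev (mkseq xi n).

Definition left_seqG : topologicalType :=
  (left_seq * discrete_topology G)%type.

Definition asymp_equiv (p q : left_seqG) : Prop :=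
  exists (K : set G) (gs : nat -> G), finite_set K /\
    forall n, (1 <= n)%N ->
      K (gs n) /\
      A (gs n) (suffix_word p.1 n) = suffix_word q.1 n /\
      restr (gs n) (suffix_word p.1 n) * (p.2 : G) = (q.2 : G).

Lemma act_inj g : injective (A g).
Proof.
by move=> v w e; rewrite -(act1 A v) -(act1 A w) -(mulVg g) !actM e.
Qed.

Lemma act_eq g h : (forall w, A g w = A h w) -> g = h.
Proof.
move=> e; suff: h^-1 * g = 1 by move/(congr1 (fun k => h * k)); rewrite mulVKg mulg1.
by apply: (@act_faithful _ _ A) => w; rewrite actM e -actM mulVg act1.
Qed.

Lemma act_nil g : A g [::] = [::].
Proof.
case e: (A g [::]) => [//|x w].
have [h [y hy]] := act_selfsim A g^-1 x.
by have := hy w; rewrite -e -actM mulVg act1.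
Qed.

Lemma restr1E g x w : A g (x :: w) = letter_act g x :: A (restr1 g x) w.
Proof.
have [h [y hy]] := act_selfsim A g x.
have : exists h, [set h | exists y, forall w, A g (x :: w) = y :: A h w] h.
  by exists h, y.
move=> [k /(xgetI 1)] [z hz].
by rewrite /letter_act [in head _ _]hz hz.
Qed.

Lemma restr1_uniq g x h y :
  (forall w, A g (x :: w) = y :: A h w) -> y = letter_act g x /\ h = restr1 g x.
Proof.
move=> e; split; first by rewrite /letter_act e.
by apply: act_eq => w; have := e w; rewrite restr1E => -[_ ->].
Qed.

Lemma size_act g v : size (A g v) = size v.
Proof. by elim: v g => [|x v IH] g; rewrite ?act_nil // restr1E /= IH. Qed.

Lemma act_cat g v w : A g (v ++ w) = A g v ++ A (restr g v) w.
Proof.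
by elim: v g => [|x v IH] g /=; rewrite ?act_nil // !restr1E IH.
Qed.

Lemma restr_uniq g v h :
  (forall w, A g (v ++ w) = A g v ++ A h w) -> h = restr g v.
Proof.
move=> e; apply: act_eq => w; have := e w; rewrite act_cat => /eqP.
by rewrite eqseq_cat // eqxx => /eqP ->.
Qed.

Lemma restrM g h v : restr (g * h) v = restr g (A h v) * restr h v.
Proof. by apply/esym/restr_uniq => w; rewrite !actM !act_cat. Qed.

Lemma restr_1 v : restr 1 v = 1.
Proof. by apply/esym/restr_uniq => w; rewrite !act1. Qed.

Lemma restrV g v : restr g^-1 (A g v) = (restr g v)^-1.
Proof. by apply/eqP; rewrite -mulg_eq1 -restrM mulVg restr_1. Qed.

Lemma asymp_refl p : asymp_equiv p p.
Proof.
exists [set 1], (fun=> 1); split; first exact: finite_set1.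
by move=> n _; rewrite act1 restr_1 mul1g.
Qed.

Lemma asymp_sym p q : asymp_equiv p q -> asymp_equiv q p.
Proof.
move=> [K [gs [fK H]]].
exists [set g^-1 | g in K], (fun n => (gs n)^-1); split.
  exact: finite_image.
move=> n n1; have [Kn [e1 e2]] := H n n1; split; first by exists (gs n).
by rewrite -e1 -e2 restrV mulKg -actM mulVg act1.
Qed.

Lemma asymp_trans p q r :
  asymp_equiv p q -> asymp_equiv q r -> asymp_equiv p r.
Proof.
move=> [K [gs [fK H]]] [L [hs [fL I]]].
exists [set l * k | l in L & k in K], (fun n => hs n * gs n); split.
  exact: finite_image2.
move=> n n1; have [Kn [e1 e2]] := H n n1; have [Ln [f1 f2]] := I n n1.
split; first by exists (hs n) => //; exists (gs n).
by rewrite restrM actM e1 f1 -mulgA e2 f2.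
Qed.

Lemma asymp_equiv_class : equiv_class_of (fun p q => `[< asymp_equiv p q >]).
Proof.
split=> [p|p q|q p r].
- by apply/asboolP; exact: asymp_refl.
- by apply/asboolP/asboolP; exact: asymp_sym.
- move=> /asboolP pq /asboolP qr; apply/asboolP; exact: asymp_trans pq qr.
Qed.

Definition asymp_rel : equiv_rel left_seqG := EquivRelPack asymp_equiv_class.

(* quotient_topology is the quotient set with the quotient topology. *)
Definition limitGspace := quotient_topology {eq_quot asymp_rel}.

Definition limit_pi : left_seqG -> limitGspace := \pi_limitGspace.

Lemma limit_piP p q : limit_pi p = limit_pi q <-> asymp_equiv p q.
Proof.
have eP := @eqquotP _ asymp_rel {eq_quot asymp_rel} p q.
by split=> [/eP/asboolP|e] //; apply/eP/asboolP.
Qed.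

(* The right action [(xi, g)] . h = [(xi, g h)], see [limit_actE]. *)
Definition limit_act (c : limitGspace) (h : G) : limitGspace :=
  limit_pi ((repr c).1, ((repr c).2 : G) * h).

Lemma limit_actE (xi : left_seq) g h :
  limit_act (limit_pi (xi, g)) h = limit_pi (xi, g * h).
Proof.
apply/limit_piP; have : asymp_equiv (repr (limit_pi (xi, g))) (xi, g).
  by apply/limit_piP; rewrite /limit_pi reprK.
move=> [K [gs [fK H]]]; exists K, gs; split=> // n n1.
by have [Kn [e1 e2]] := H n n1; rewrite /= mulgA e2.
Qed.

Definition tile : set limitGspace :=
  limit_pi @` (setT `*` [set 1 : G]).

Definition translate (T : set limitGspace) (h : G) : set limitGspace :=
  (fun c => limit_act c h) @` T.

Lemma absorbingI (N M : set G) :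
  absorbing N -> absorbing M -> absorbing (N `&` M).
Proof.
move=> [fN HN] [_ HM]; split; first exact: finite_setIl.
move=> g; have [k Hk] := HN g; have [l Hl] := HM g; exists (maxn k l) => v.
by rewrite geq_max => /andP[kv lv]; split; [exact: Hk|exact: Hl].
Qed.

Lemma nucleusP : contracting ->
  absorbing nucleus /\ forall N, absorbing N -> nucleus `<=` N.
Proof.
move=> [N aN]; split; last by move=> M aM g; apply.
have /finite_seqP[s Ns] := aN.1.
have [M [aM MN Ms]] : exists M, [/\ absorbing M, M `<=` N &
    forall h, h \in s -> M h -> nucleus h].
  elim: s {Ns} => [|h s [M [aM MN Ms]]]; first by exists N; split.
  have [nh|/existsNP[L /not_implyP[aL Lh]]] := pselect (nucleus h).
    by exists M; split => // k; rewrite inE => /orP[/eqP ->|/Ms].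
  exists (M `&` L); split; first exact: absorbingI.
    by move=> k [/MN].
  by move=> k; rewrite inE => /orP[/eqP -> []|ks [/(Ms _ ks)]].
have sub : M `<=` nucleus.
  by move=> h Mh; apply: (Ms h) => //; have := MN _ Mh; rewrite Ns.
split; first by apply: sub_finite_set aN.1 => g; apply.
by move=> g; have [k Hk] := aM.2 g; exists k => v /Hk /sub.
Qed.

End SelfSimilar.

Arguments nucleus {G X} A _.
Arguments nucleusF {G X} A h _.
Arguments limit_pi {G X} A p.
Arguments tile {G X} A _.
Arguments translate {G X A} T h _.

(* Main.v *)
(** A point [(xi, g)] lies over [T . g1] iff it is asymptotically equivalent to
    some [(eta, g1)], so everything reduces to the case of one tile: such an
    [eta] exists iff [h = g1 g^-1] lies in the nucleus and [xi] in [F_h].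
    A path in the nucleus yields [eta] by reading off the second coordinates of
    its labels.  Conversely, if elements [g_n] of a finite set satisfy
    [g_n|_(x_n...x_1) = h], then the restrictions of [g_n] to long enough
    prefixes of [x_n...x_1] are in the nucleus, and Koenig's lemma extracts a
    left-infinite path from these longer and longer finite paths ending in
    [h]. *)
Require Import Defs.
From HB Require Import structures.
From mathcomp Require Import all_boot.
From mathcomp Require Import all_classical topology.
Set Implicit Arguments.
Unset Strict Implicit.
Unset Printing Implicit Defensive.

Local Open Scope classical_set_scope.
Local Open Scope group_scope.

Lemma finite_set_uniform_bound (T : choiceType) (K : set T)
    (P : T -> nat -> Prop) :
  finite_set K -> (forall t, exists k, forall n, (k <= n)%N -> P t n) ->
  exists k, forall t, K t -> forall n, (k <= n)%N -> P t n.
Proof.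
move=> /finite_seqP[s ->] /choice[b bP]; exists (\max_(t <- s) b t) => t ts n le_n.
by apply: bP; apply: leq_trans le_n; exact: leq_bigmax_seq.
Qed.

(** If each value in [N] were eventually avoided, a common bound past which all of them are avoided
    would contradict [often]. *)
Lemma infinite_pigeonhole (T : choiceType) (N : set T) (f : nat -> T) :
  finite_set N -> (forall b, exists2 k, (b <= k)%N & N (f k)) ->
  exists2 t, N t & forall b, exists2 k, (b <= k)%N & f k = t.
Proof.
move=> fN often; apply: contrapT => none.
have /(finite_set_uniform_bound fN)[b bP] : forall t, exists b, forall k,
    (b <= k)%N -> N t -> f k <> t.
  move=> t; apply: contrapT => tP; have [Nt|Nt] := pselect (N t); last first.
    by apply: tP; exists 0%N.
  apply: none; exists t => // b; apply: contrapT => bP; apply: tP; exists b.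
  by move=> k bk _ fk; apply: bP; exists k.
by have [k bk Nfk] := often b; exact: (bP _ Nfk k bk Nfk).
Qed.

Section Tiles.
Variables (G : groupType) (X : finType) (A : selfsim_action G X).
Implicit Types (g h : G) (xi eta : left_seq X).

(* the word x_(n+k) ... x_(n+1) *)
Definition segment xi n k : seq X := rev [seq xi i | i <- iota n k].

Lemma segmentS xi n k : segment xi n k.+1 = rcons (segment xi n.+1 k) (xi n).
Proof. by rewrite /segment /= rev_cons. Qed.

Lemma size_segment xi n k : size (segment xi n k) = k.
Proof. by rewrite size_rev size_map size_iota. Qed.

Lemma restr_rcons g v x : restr A g (rcons v x) = restr1 A (restr A g v) x.
Proof. by rewrite /restr foldl_rcons. Qed.

Lemma suffix_wordS xi n : suffix_word xi n.+1 = xi n :: suffix_word xi n.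
Proof. by rewrite /suffix_word mkseqS rev_rcons. Qed.

Lemma asymp_of_nucleusF xi g h : contracting A -> nucleusF A h xi ->
  exists eta, asymp_equiv A (xi, g) (eta, h * g).
Proof.
move=> /nucleusP[[fN _] _] [e [[srcN [_ consec]] [e0 lab]]].
(* The edge e_n is [e n.-1], and g_n is its source; index 0 is excluded by [1 <= n]. *)
exists (fun n => letter_act A (e n).1 (xi n)), (nucleus A), (fun n => (e n.-1).1).
have stepS n : restr1 A (e n.+1).1 (xi n.+1) = (e n).1.
  by rewrite -(lab n.+1); exact: consec.
split=> // -[//|n] _ /=; split; first exact: srcN.
elim: n => [|n [IHa IHr]].
  by rewrite !suffix_wordS /restr /= restr1E act_nil -(lab 0%N) -e0.
rewrite suffix_wordS restr1E [in RHS]suffix_wordS stepS IHa.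
by rewrite /restr /= stepS.
Qed.

Lemma nucleusF_of_asymp xi eta g h : contracting A ->
  asymp_equiv A (xi, g) (eta, h * g) -> nucleus A h /\ nucleusF A h xi.
Proof.
move=> /nucleusP[[fN absN] _] [K [gs [fK gsP]]].
have [m mP] : exists m, forall k, K k -> forall n, (m <= n)%N ->
    forall v, size v = n -> nucleus A (restr A k v).
  apply: finite_set_uniform_bound => // k; have [m mP] := absN k.
  by exists m => n mn v vn; apply: mP; rewrite vn.
(* The vertex n edges before the end of the path that starts at [gs (n + k)] and reads x_(n+k) ...
   x_1. *)
pose state n k := restr A (gs (n + k)%N) (segment xi n k).
(* Koenig's condition: [a] occurs at level n of arbitrarily long paths of this kind. *)
pose recurrent n a := forall b, exists2 k, (b <= k)%N & state n k = a.
(* The strict bound also ensures [1 <= n + k], as [gsP] requires. *)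
have stateN n k : (m < k)%N -> nucleus A (state n k).
  move=> mk; apply: (mP _ _ k (ltnW mk)); last exact: size_segment.
  have [] // := gsP (n + k)%N.
  by rewrite (leq_trans _ (leq_addl _ _)) // (leq_trans _ mk).
have stateS n k : state n k.+1 = restr1 A (state n.+1 k) (xi n).
  by rewrite /state segmentS restr_rcons addSnnS.
have recN n a : recurrent n a -> nucleus A a.
  by move=> /(_ m.+1)[k mk <-]; exact: stateN.
have rec0 : recurrent 0%N h.
  move=> b; exists b.+1 => //.
  by have [_ [_ /= /mulIg]] := gsP b.+1 isT.
(* Recurrence is a premise under the existential, so that [choice] yields a total function; 1 is an
   arbitrary witness where it fails. *)
have recS (na : nat * G) : exists b,
    recurrent na.1 na.2 -> recurrent na.1.+1 b /\ restr1 A b (xi na.1) = na.2.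
  case: na => n a /=; have [ra|] := pselect (recurrent n a); last by exists 1.
  have [|b|b [_ ba] rb] := @infinite_pigeonhole _
      (nucleus A `&` [set b | restr1 A b (xi n) = a]) (state n.+1).
  - exact: finite_setIl.
  (* The outer successor pays for the step from [state n k.+1] back to [state n.+1 k]; [m.+1] is
     what [stateN] needs. *)
  - have [[//|k] bk ska] := ra (maxn b m.+1).+1.
    move: bk; rewrite ltnS geq_max => /andP[bk mk].
    by exists k => //; split; [exact: stateN|rewrite /= -stateS].
  - by exists b.
have [next nextP] := choice recS.
pose s := fix s n := if n is n'.+1 then next (n', s n') else h.
have rs n : recurrent n (s n).
  by elim: n => [|n IH] //=; case: (nextP (n, s n) IH).
have sS n : restr1 A (s n.+1) (xi n) = s n.
  by case: (nextP (n, s n) (rs n)).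
split; first exact: recN rec0.
(* Sources are shifted by one so that the last edge ends in [s 0], which is [h]. *)
exists (fun n => (s n.+1, xi n)); split; last by split=> //; exact: sS.
split=> [n|]; first exact: recN (rs n.+1).
split=> n; rewrite /edge_target /edge_source /= sS //.
exact: recN (rs n).
Qed.

Lemma translate_tileE p g1 :
  translate (tile A) g1 (limit_pi A p) <->
  exists eta, asymp_equiv A p (eta, g1).
Proof.
split=> [[_ [[eta k] [_ /= ->] <-]]|[eta /limit_piP ->]].
  by rewrite limit_actE mul1g => /esym/limit_piP; exists eta.
exists (limit_pi A (eta, 1)); last by rewrite limit_actE mul1g.
by exists (eta, 1).
Qed.

Lemma translate_tileP xi g g1 : contracting A ->
  translate (tile A) g1 (limit_pi A (xi, g)) <->
  nucleus A (g1 * g^-1) /\ nucleusF A (g1 * g^-1) xi.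
Proof.
move=> cA; rewrite translate_tileE; split=> [[eta]|[_ /(asymp_of_nucleusF g cA)]].
  by rewrite -{1}(mulgVK g g1); exact: nucleusF_of_asymp.
by rewrite mulgVK.
Qed.

End Tiles.

Theorem mainTheorem10 (G : groupType) (X : finType) (X_nonempty : (0 < #|X|)%N)
    (A : selfsim_action G X) (A_contracting : contracting A) (g1 g2 : G) :
  limit_pi A @^-1`
    (translate (tile A) g1 `&` translate (tile A) g2) =
  \bigcup_(h in [set h : G * G | nucleus A h.1 /\ nucleus A h.2 /\
                                 g1 * g2^-1 = h.1 * h.2^-1])
    ((nucleusF A h.1 `&` nucleusF A h.2) `*` [set h.1^-1 * g1]).
Proof.
apply/seteqP; split=> -[xi g] /=.
  move=> [/(translate_tileP _ _ _ A_contracting)[N1 F1]].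
  move=> /(translate_tileP _ _ _ A_contracting)[N2 F2].
  exists (g1 * g^-1, g2 * g^-1) => /=.
    by split=> //; split=> //; rewrite invgM invgK mulgA mulgVK.
  by split=> //=; rewrite invgM invgK mulgVK.
move=> [[h1 h2] /= [N1 [N2 e12]] [/= [F1 F2] ->]].
have e1 : g1 * (h1^-1 * g1)^-1 = h1 by rewrite invgM invgK mulgA mulgV mul1g.
(* By [e12], h1^-1 g1 = h2^-1 g2, so the second coordinate is symmetric in the two tiles. *)
have e2 : g2 * (h1^-1 * g1)^-1 = h2.
  rewrite invgM invgK.
  have -> : h1 = g1 * g2^-1 * h2 by rewrite e12 mulgVK.
  by rewrite -[g1 * _ * _]mulgA mulKg mulVKg.
by split; apply/translate_tileP; rewrite ?e1 ?e2.
Qed.
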